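(* Let $\lambda\in\mathbb{C}$ with $|\lambda|=1$ and let $\varphi\in S(\mathbb{D})$. Suppose that the composition operator $C_\varphi$ is bounded on the Besov space $B_1$. Then the operator $\lambda C_\varphi$ is not hypercyclic on $B_1$.
   Context: $\mathbb{D}=\{z\in\mathbb{C}:|z|<1\}$, $H(\mathbb{D})$ is the space of holomorphic functions on $\mathbb{D}$, and $S(\mathbb{D})$ is the set of all holomorphic self-maps of $\mathbb{D}$. For $\varphi\in S(\mathbb{D})$, $C_\varphi f=f\circ\varphi$ for $f\in H(\mathbb{D})$. For $a\in\mathbb{D}$ let $\varphi_a(z)=\frac{a-z}{1-\bar a z}$. The Besov space $B_1$ consists of the analytic functions $f$ on $\mathbb{D}$ that admit a representation $f(z)=\sum_{n=1}^\infty a_n\varphi_{\lambda_n}(z)$, $z\in\mathbb{D}$, with $\{a_n\}\in\ell^1$ and $\lambda_n\in\mathbb{D}$, with norm $\|f\|_{B_1}=\inf\{\sum_{n=1}^\infty|a_n|: f(z)=\sum_{n=1}^\infty a_n\varphi_{\lambda_n}(z),\ z\in\mathbb{D}\}$. (Equivalently, as a set, $B_1=\{f\in H(\mathbb{D}):\int_{\mathbb{D}}|f''(z)|\,dA(z)<\infty\}$, where $dA$ is Lebesgue area measure.) ''$C_\varphi$ is bounded on $B_1$'' means that $C_\varphi$ is a bounded linear operator from $B_1$ to $B_1$. A continuous linear operator $T$ on a separable infinite-dimensional Banach space $X$ is hypercyclic if there is $f\in X$ whose orbit $\{T^nf:n=0,1,2,\dots\}$ is dense in $X$. *)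

(* Defs.v *)
From HB Require Import structures.
From mathcomp Require Import all_boot all_order all_algebra.
From mathcomp Require Import complex ring.
From mathcomp Require Import all_classical all_reals all_analysis.

Set Implicit Arguments.
Unset Strict Implicit.
Unset Printing Implicit Defensive.

Import Order.TTheory GRing.Theory Num.Theory.
Import numFieldNormedType.Exports.
Import ComplexField.Normc.

Local Open Scope classical_set_scope.
Local Open Scope ring_scope.

(* [R[i]] carries no topology in the library; it gets the one of its norm. *)
HB.instance Definition _ (R : realType) := NormedModule.copy R[i] R[i]^o.

Definition unit_disk (C : numDomainType) : pred C := fun z => `|z| < 1.

Definition disk (R : realType) : Type := {z : R[i] | unit_disk z}.

Section HolomorphicFunctions.
Variable R : realType.

Definition zero_ext (f : disk R -> R[i]) (z : R[i]) : R[i] :=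
  if insub z is Some u then f u else 0.

(* The scalar field is [R[i]], so derivability in the direction 1 is complex
   differentiability; the values of [zero_ext f] off the open disk are
   irrelevant to it at a point of the disk. *)
Definition holomorphic (f : disk R -> R[i]) : Prop :=
  forall z : disk R, derivable (zero_ext f) (val z) 1.

Definition holomorphic_self_map (phi : disk R -> disk R) : Prop :=
  holomorphic (fun z => val (phi z)).

Definition mobius (a z : disk R) : R[i] :=
  (val a - val z) / (1 - (val a)^* * val z).

End HolomorphicFunctions.

Section BesovB1.
Variable R : realType.
Implicit Types (f g : disk R -> R[i]) (a : R[i] ^nat) (l : (disk R) ^nat).

(* [normc] is the modulus with values in [R]; the norm [`|_|] of [R[i]] takes
   its values in [R[i]]. *)
Definition summable1 a : Prop := cvgn (series (fun n => normc (a n))).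

Definition norm1 a : R := limn (series (fun n => normc (a n))).

Definition mobius_rep f a l : Prop :=
  summable1 a /\
  forall z : disk R, series (fun n => a n * mobius (l n) z) @ \oo --> f z.

Definition B1_set : set (disk R -> R[i]) :=
  [set f | holomorphic f /\ exists a l, mobius_rep f a l].

Definition B1_pred : {pred (disk R -> R[i])} := fun f => `[< B1_set f >].

Definition B1_sums f : set R :=
  [set s | exists a l, mobius_rep f a l /\ s = norm1 a].

Definition B1_norm f : R := inf (B1_sums f).

End BesovB1.

Lemma mobius_identity (C : numClosedFieldType) (a z : C) :
  (1 - a^* * z) * (1 - a^* * z)^* - (a - z) * (a - z)^* =
  (1 - a * a^*) * (1 - z * z^*).
Proof. by rewrite !rmorphB rmorphM rmorph1 /= conjCK; ring. Qed.

Section BesovB1Theory.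
Variable R : realType.
Implicit Types (f g : disk R -> R[i]) (a : R[i] ^nat) (l : (disk R) ^nat).

Lemma norm_normc (z : R[i]) : `|z| = (normc z)%:C%C.
Proof. by case: z. Qed.

Lemma normc_ge0 (z : R[i]) : 0 <= normc z.
Proof. by case: z => x y; exact: sqrtr_ge0. Qed.

Lemma mobius_le1 (a z : disk R) : normc (mobius a z) <= 1.
Proof.
case: a z => [a +] [z +]; rewrite /unit_disk => a1 z1.
rewrite /mobius /= -lecR -norm_normc normrM normfV.
have sq (w : R[i]) : `|w| < 1 -> w * w^* < 1.
  by move=> w1; rewrite -normCK expr_lt1.
have d0 : 1 - a^* * z != 0.
  rewrite subr_eq0 eq_sym; apply/eqP => /(congr1 (fun w : R[i] => `|w|)).
  rewrite normrM normr1 norm_conjC => h.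
  by have := mulr_ilt1 (normr_ge0 a) (normr_ge0 z) a1 z1; rewrite h ltxx.
rewrite ler_pdivrMr ?normr_gt0// mul1r -ler_sqr ?nnegrE//.
rewrite !normCK -subr_ge0.
rewrite (_ : _ - _ = (1 - a * a^*) * (1 - z * z^*)).
  by rewrite mulr_ge0// subr_ge0 ltW// sq.
exact: mobius_identity.
Qed.

Lemma norm_ge1 (z : R[i]) (e : R) : (`|z| <= e%:C%C) = (normc z <= e).
Proof. by rewrite norm_normc lecR. Qed.

Lemma norm1_ge0 a : summable1 a -> 0 <= norm1 a.
Proof.
move=> sa; apply: limr_ge => //; near=> n.
by apply: sumr_ge0 => i _; exact: normc_ge0.
Unshelve. all: by end_near. Qed.

Lemma mobius_rep_le f a l : mobius_rep f a l ->
  forall z, normc (f z) <= norm1 a.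
Proof.
move=> [sa fal] z; apply/ler_addgt0Pr => e e0.
have e0C : 0 < e%:C%C :> R[i] by rewrite ltcR.
have /cvgrPdist_lt/(_ _ e0C)[N _ /(_ N)/= /(_ (leqnn _))] := fal z.
set S := series _ N => fS.
have SN : normc S <= norm1 a.
  rewrite /S /series /=; apply: (@le_trans _ _ (series (fun n => normc (a n)) N)).
    rewrite -norm_ge1 (le_trans (ler_norm_sum _ _ _))// /series /= rmorph_sum.
    apply: ler_sum => i _; rewrite norm_normc lecR normcM.
    by rewrite ler_piMr ?mobius_le1// normc_ge0.
  apply: nondecreasing_cvgn_le => //; apply/nondecreasing_seqP => n.
  by rewrite !seriesEnat /= big_nat_recr//= lerDl normc_ge0.
rewrite -(subrK S (f z)) (le_trans (le_normcD _ _))// addrC lerD//.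
by rewrite -norm_ge1 ltW.
Qed.

Definition interleave (T : Type) (u v : nat -> T) (n : nat) : T :=
  if odd n then v n./2 else u n./2.

Lemma series_interleave (V : zmodType) (u v : V ^nat) n :
  series (interleave u v) n = series u (uphalf n) + series v n./2.
Proof.
elim: n => [|n ih]; first by rewrite !seriesEnat /= !big_geq// addr0.
rewrite seriesSr ih /interleave [uphalf n.+1]/= [n.+1./2]/= uphalf_half.
case: (odd n); rewrite /= ?add0n ?add1n.
  by rewrite (seriesSr v) addrA.
by rewrite (seriesSr u) addrAC.
Qed.

Lemma cvg_series_interleave (K : numFieldType) (V : normedModType K)
    (u v : V ^nat) (x y : V) :
  series u @ \oo --> x -> series v @ \oo --> y ->
  series (interleave u v) @ \oo --> x + y.
Proof.
move=> ux vy.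
have half_oo : half @ \oo --> \oo.
  by apply/cvgnyPge => m; exists m.*2 => //= n /= /half_leq; rewrite doubleK.
have uphalf_oo : uphalf @ \oo --> \oo.
  apply/cvgnyPge => m; exists m.*2 => //= n /=.
  move=> /half_leq; rewrite doubleK uphalf_half => /leq_trans; apply.
  exact: leq_addl.
rewrite (_ : series _ = (series u \o uphalf) + (series v \o half)).
  by apply: cvgD; [exact: cvg_comp ux|exact: cvg_comp vy].
by apply/funext => n; rewrite series_interleave.
Qed.

Lemma mobius_repD f g a b l m : mobius_rep f a l -> mobius_rep g b m ->
  mobius_rep (f + g) (interleave a b) (interleave l m) /\
  norm1 (interleave a b) = norm1 a + norm1 b.
Proof.
move=> [sa fal] [sb gbm].
have E : (fun n => normc (interleave a b n)) =
    interleave (fun n => normc (a n)) (fun n => normc (b n)).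
  by apply/funext => n; rewrite /interleave; case: ifP.
have := cvg_series_interleave sa sb; rewrite -E => ab.
split; last by rewrite /norm1; exact: cvg_lim ab.
split; first by apply/cvg_ex; eexists; exact: ab.
move=> z; rewrite (_ : (fun n => _) =
    interleave (fun n => a n * mobius (l n) z) (fun n => b n * mobius (m n) z)).
  exact: cvg_series_interleave (fal z) (gbm z).
by apply/funext => n; rewrite /interleave; case: ifP.
Qed.

Lemma mobius_repZ (c : R[i]) f a l : mobius_rep f a l ->
  mobius_rep (c *: f) (fun n => c * a n) l /\
  norm1 (fun n => c * a n) = normc c * norm1 a.
Proof.
move=> [sa fal].
have E : (fun n => normc (c * a n)) = normc c *: (fun n => normc (a n)).
  by apply/funext => n; rewrite normcM.
have ca : series (fun n => normc (c * a n)) @ \oo --> normc c * norm1 a.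
  by rewrite E seriesZ; apply: cvgZr.
split; last exact: cvg_lim ca.
split; first by apply/cvg_ex; eexists; exact: ca.
move=> z; rewrite (_ : (fun n => _) = c *: (fun n => a n * mobius (l n) z)).
  by rewrite seriesZ; exact: cvgZr (fal z).
by apply/funext => n; rewrite -mulrA.
Qed.

Lemma zero_extD f g : zero_ext (f + g) = zero_ext f + zero_ext g.
Proof.
apply/funext => z; rewrite -[RHS]/(zero_ext f z + zero_ext g z) /zero_ext.
by case: insub => [u|] //; rewrite addr0.
Qed.

Lemma zero_extZ (c : R[i]) f : zero_ext (c *: f) = c *: zero_ext f.
Proof.
apply/funext => z; rewrite -[RHS]/(c *: zero_ext f z) /zero_ext.
by case: insub => [u|] //; rewrite scaler0.
Qed.

Lemma holomorphicD f g : holomorphic f -> holomorphic g -> holomorphic (f + g).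
Proof. by move=> hf hg z; rewrite zero_extD; exact: derivableD. Qed.

Lemma holomorphicZ (c : R[i]) f : holomorphic f -> holomorphic (c *: f).
Proof. by move=> hf z; rewrite zero_extZ; exact: derivableZ. Qed.

Lemma holomorphic0 : holomorphic (0 : disk R -> R[i]).
Proof.
move=> z; rewrite (_ : zero_ext 0 = cst 0); first exact: derivable_cst.
by apply/funext => w; rewrite /zero_ext; case: insub.
Qed.

Lemma B1_set0 : B1_set (0 : disk R -> R[i]).
Proof.
split; first exact: holomorphic0.
have s0 (V : zmodType) : series (fun=> 0 : V) = fun=> 0.
  by apply/funext => n; rewrite /series /= big1.
have d0 : unit_disk (0 : R[i]) by rewrite /unit_disk normr0.
exists (fun=> 0), (fun=> Sub 0 d0); split.
  rewrite /summable1 (_ : (fun n => _) = fun=> 0); last first.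
    by apply/funext => n; rewrite normc0.
  by rewrite s0; exact: is_cvg_cst.
move=> z; rewrite (_ : (fun n => _) = fun=> 0); last first.
  by apply/funext => n; rewrite mul0r.
by rewrite s0; exact: cvg_cst.
Qed.

Lemma B1_setD f g : B1_set f -> B1_set g -> B1_set (f + g).
Proof.
move=> [hf [a [l fal]]] [hg [b [m gbm]]]; split; first exact: holomorphicD.
by have [fg _] := mobius_repD fal gbm; do 2 eexists; exact: fg.
Qed.

Lemma B1_setZ (c : R[i]) f : B1_set f -> B1_set (c *: f).
Proof.
move=> [hf [a [l fal]]]; split; first exact: holomorphicZ.
by have [cf _] := mobius_repZ c fal; do 2 eexists; exact: cf.
Qed.

Lemma B1_linear_closed :
  ((0 : disk R -> R[i]) \in @B1_pred R /\
   {in @B1_pred R &, forall f g, f + g \in @B1_pred R}) /\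
  forall c : R[i], {in @B1_pred R, forall f, c *: f \in @B1_pred R}.
Proof.
do 2?split; first exact/asboolP/B1_set0.
- by move=> f g /asboolP Bf /asboolP Bg; apply/asboolP; exact: B1_setD.
- by move=> c f /asboolP Bf; apply/asboolP; exact: B1_setZ.
Qed.

Lemma B1_sums_ge0 f s : B1_sums f s -> 0 <= s.
Proof. by move=> [a [l [[sa _] ->]]]; exact: norm1_ge0. Qed.

Lemma B1_norm_le f a l : mobius_rep f a l -> B1_norm f <= norm1 a.
Proof.
move=> fal; apply: ge_inf; last by exists a, l.
by exists 0 => s /B1_sums_ge0.
Qed.

Lemma B1_norm_ge f (x : R) : B1_set f ->
  (forall a l, mobius_rep f a l -> x <= norm1 a) -> x <= B1_norm f.
Proof.
move=> [_ [a [l fal]]] xf; apply: lb_le_inf; first by exists (norm1 a), a, l.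
by move=> _ [b [m [fbm ->]]]; exact: xf fbm.
Qed.

Lemma B1_norm_ge0 f : B1_set f -> 0 <= B1_norm f.
Proof. by move=> /B1_norm_ge; apply => a l [sa _]; exact: norm1_ge0. Qed.

Lemma normc_le_B1_norm f z : B1_set f -> normc (f z) <= B1_norm f.
Proof. by move=> /B1_norm_ge; apply => a l /mobius_rep_le. Qed.

Lemma B1_normD f g : B1_set f -> B1_set g ->
  B1_norm (f + g) <= B1_norm f + B1_norm g.
Proof.
move=> Bf Bg; rewrite -lerBlDr; apply: B1_norm_ge => // a l fal.
rewrite lerBlDr -lerBlDl; apply: B1_norm_ge => // b m gbm; rewrite lerBlDl.
by have [fg <-] := mobius_repD fal gbm; exact: B1_norm_le fg.
Qed.

Lemma B1_normZ_le (c : R[i]) f : B1_set f ->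
  B1_norm (c *: f) <= normc c * B1_norm f.
Proof.
move=> Bf; have [->|c0] := eqVneq c 0.
  have [_ [a [l fal]]] := Bf; have [cf E] := mobius_repZ 0 fal.
  by rewrite normc0 mul0r (le_trans (B1_norm_le cf))// E normc0 mul0r.
have nc : 0 < normc c.
  rewrite lt_neqAle normc_ge0 eq_sym andbT.
  by apply: contra c0 => /eqP/eq0_normc->.
rewrite mulrC -ler_pdivrMr//; apply: B1_norm_ge => // a l fal.
rewrite ler_pdivrMr// mulrC.
by have [cf <-] := mobius_repZ c fal; exact: B1_norm_le cf.
Qed.

Lemma B1_normZ (c : R[i]) f : B1_set f ->
  B1_norm (c *: f) = normc c * B1_norm f.
Proof.
move=> Bf; apply/eqP; rewrite eq_le B1_normZ_le//=.
have [->|c0] := eqVneq c 0.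
  by rewrite normc0 mul0r; apply: B1_norm_ge0; exact: (B1_setZ 0 Bf).
have := B1_normZ_le c^-1 (B1_setZ c Bf).
rewrite scalerA mulVf// scale1r => /(ler_wpM2l (normc_ge0 c)) /le_trans; apply.
by rewrite mulrA -normcM divff// normc1 mul1r.
Qed.

End BesovB1Theory.

HB.instance Definition _ (R : realType) :=
  GRing.isSubmodClosed.Build R[i] (disk R -> R[i]) (@B1_pred R)
    (@B1_linear_closed R).

Record B1 (R : realType) : Type := mkB1 {
  B1_fun :> disk R -> R[i];
  B1_funP : B1_fun \in @B1_pred R }.

HB.instance Definition _ (R : realType) := [isSub for @B1_fun R].
HB.instance Definition _ (R : realType) := [Choice of B1 R by <:].
HB.instance Definition _ (R : realType) :=
  [SubChoice_isSubLmodule of B1 R by <:].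

Section B1NormedModule.
Variable R : realType.
Implicit Types f g : B1 R.

Lemma B1_inP f : B1_set f.
Proof. exact/asboolP/(B1_funP f). Qed.

(* The norm of a normed module over [R[i]] takes its values in [R[i]]. *)
Definition B1_normC f : R[i] := (B1_norm f)%:C%C.

Fact B1_normC_D f g : B1_normC (f + g) <= B1_normC f + B1_normC g.
Proof.
rewrite /B1_normC -rmorphD lecR /=.
exact: B1_normD (B1_inP f) (B1_inP g).
Qed.

Fact B1_normC_Z (c : R[i]) f : B1_normC (c *: f) = `|c| * B1_normC f.
Proof. by rewrite /B1_normC norm_normc -rmorphM -B1_normZ//; exact: B1_inP. Qed.

Fact B1_normC_eq0 f : B1_normC f = 0 -> f = 0.
Proof.
move=> -[f0]; apply/val_inj/funext => z /=; apply: eq0_normc.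
apply/eqP; rewrite eq_le normc_ge0 andbT -f0.
exact: normc_le_B1_norm (B1_inP f).
Qed.

HB.instance Definition _ :=
  Lmodule_isNormed.Build R[i] (B1 R) B1_normC_D B1_normC_Z B1_normC_eq0.

Lemma B1_normE f : `|f| = (B1_norm f)%:C%C.
Proof. by []. Qed.

Lemma B1_addE f g : f + g = f \+ g :> (disk R -> R[i]).
Proof. by []. Qed.

Lemma B1_scaleE (c : R[i]) f :
  c *: f = c \*: (f : disk R -> R[i]) :> (disk R -> R[i]).
Proof. by []. Qed.

End B1NormedModule.

Section Operators.
Variables (K : numFieldType) (X : normedModType K).

Definition bounded_operator (T : {linear X -> X}) : Prop :=
  exists M : K, forall x, `|T x| <= M * `|x|.

(* Separability, completeness and infinite dimension of [X] do not enter the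
   condition on [T]. *)
Definition hypercyclic (T : {linear X -> X}) : Prop :=
  continuous T /\ exists x, dense (range (fun n => iter n T x)).

End Operators.

(* [T] is the operator induced on [B1 R] by [f |-> f \o phi]; its existence says
   that composition with [phi] maps [B1 R] into itself. *)
Definition is_composition_operator (R : realType) (phi : disk R -> disk R)
    (T : B1 R -> B1 R) : Prop :=
  forall f : B1 R, T f = f \o phi :> (disk R -> R[i]).

(* Main.v *)
Require Import Defs.
From HB Require Import structures.
From mathcomp Require Import all_boot all_order all_algebra.
From mathcomp Require Import complex.
From mathcomp Require Import all_classical all_reals all_analysis.

Set Implicit Arguments.
Unset Strict Implicit.
Unset Printing Implicit Defensive.

Import Order.TTheory GRing.Theory Num.Theory.
Import numFieldNormedType.Exports.

Local Open Scope classical_set_scope.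
Local Open Scope ring_scope.

Import ComplexField.Normc.

(** A Moebius map of the disk has modulus at most 1, so the norm of [B1]
    dominates the supremum norm ([normc_le_B1_norm]).  Composition with a
    self-map does not increase the supremum norm, and neither does a unimodular
    factor: along the orbit of [f] under [lambda \*: C_phi], all values at all
    points of the disk are bounded by the [B1] norm of [f]
    ([iter_composition_operator]).  Evaluation at a suitable point [p] is
    continuous on [B1] and takes arbitrarily large values ([B1_unbounded_at]),
    so some [g] in [B1] stays at distance at least 1 from the whole orbit,
    which is therefore not dense. *)

Lemma near_unit_disk (R : realType) (z : R[i]) :
  unit_disk z -> \forall w \near z, unit_disk w.
Proof.
move=> z1; have e0 : 0 < 1 - `|z| by rewrite subr_gt0.
near=> w; rewrite /unit_disk -(subrK z w) (le_lt_trans (ler_normD _ _))//.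
rewrite -ltrBrDr distrC; near: w.
exact: (@cvgr_dist_lt _ _ _ _ _ id z).
Unshelve. all: by end_near. Qed.

(** [zero_ext f] agrees with [F] only on the disk, which suffices because the
    disk is a neighbourhood of each of its points. *)
Lemma holomorphic_restriction (R : realType) (f : disk R -> R[i])
    (F : R[i] -> R[i]) :
  (forall z : disk R, f z = F (val z)) ->
  (forall z : disk R, derivable F (val z) 1) -> holomorphic f.
Proof.
move=> fF dF z; apply: (near_eq_derivable _ (dF z)).
apply: filterS (near_unit_disk (valP z)) => w w1.
by rewrite /zero_ext insubT fF.
Qed.

Lemma mobius_rep_mobius (R : realType) (a : disk R) :
  mobius_rep (mobius a) (fun n => (n == 0%N)%:R) (fun=> a).
Proof.
have seriesE (V : zmodType) (u : V ^nat) n :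
    (forall k, u k.+1 = 0) -> (0 < n)%N -> series u n = u 0%N.
  case: n => // n u0 _; rewrite seriesEord /= big_ord_recl big1 ?addr0 => // i _.
  exact: u0.
split.
  apply/cvg_ex; exists 1; apply: cvg_near_cst; near=> n.
  rewrite seriesE ?normc1//; first by move=> k; rewrite normc0.
  by near: n; exact: nbhs_infty_gt.
move=> z; apply: cvg_near_cst; near=> n.
rewrite seriesE ?mul1r//; first by move=> k; rewrite mul0r.
by near: n; exact: nbhs_infty_gt.
Unshelve. all: by end_near. Qed.

Lemma unit_disk0 (C : numDomainType) : unit_disk (0 : C).
Proof. by rewrite /unit_disk normr0. Qed.

Definition disk0 (R : realType) : disk R := Sub 0 (unit_disk0 _).

Lemma mobius0 (R : realType) (z : disk R) : mobius (disk0 R) z = - val z.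
Proof. by rewrite /mobius /= conjC0 mul0r subr0 divr1 sub0r. Qed.

(** The centre 0 makes the Moebius map a polynomial, so that its holomorphy
    needs no quotient rule. *)
Lemma B1_set_mobius0 (R : realType) : B1_set (mobius (disk0 R)).
Proof.
split; last by do 2 eexists; exact: mobius_rep_mobius.
apply: (holomorphic_restriction (F := -%R)) => z; first exact: mobius0.
by apply: derivableN; exact: derivable_id.
Qed.

Lemma unit_disk_half (C : numFieldType) : unit_disk (2^-1 : C).
Proof. by rewrite /unit_disk ger0_norm ?invr_ge0// invf_lt1 ?ltr1n. Qed.

(** The witnesses are multiples of [z |-> - z]; any point other than the zero of
    that map would serve as [p]. *)
Lemma B1_unbounded_at (R : realType) :
  exists p : disk R, forall M : R, exists g : B1 R, normc (g p) = `|M|.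
Proof.
pose p : disk R := Sub 2^-1 (unit_disk_half _).
pose e : B1 R := mkB1 (introT (asboolP _) (B1_set_mobius0 R)).
exists p => M; exists ((- 2 * M%:C%C) *: e).
rewrite B1_scaleE -[LHS]/(normc (- 2 * M%:C%C * mobius (disk0 R) p)) mobius0.
rewrite -[val p]/(2^-1 : R[i]) mulrAC mulrNN divff ?pnatr_eq0// mul1r.
by rewrite /normc /= expr0n addr0 sqrtr_sqr.
Qed.

Lemma iter_composition_operator (R : realType) (lambda : R[i])
    (phi : disk R -> disk R) (T : {linear B1 R -> B1 R}) :
  `|lambda| = 1 -> is_composition_operator phi T ->
  forall n (f : B1 R) z,
    normc (iter n (lambda \*: T) f z) = normc (f (iter n phi z)).
Proof.
move=> l1 Tphi n f; have {}l1 : normc lambda = 1.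
  by move: l1; rewrite norm_normc => -[].
elim: n => // n ih z.
rewrite [iter _ phi z]iterSr -ih iterS.
set h := iter n _ f; rewrite -[LHS]/(normc (lambda * T h z)).
by rewrite normcM l1 mul1r Tphi.
Qed.

Theorem corollary3p4 (R : realType) (lambda : R[i]) (phi : disk R -> disk R)
    (C_phi : {linear B1 R -> B1 R}) :
  `|lambda| = 1 ->
  holomorphic_self_map phi ->
  is_composition_operator phi C_phi ->
  bounded_operator C_phi ->
  ~ hypercyclic (lambda \*: C_phi).
Proof.
move=> l1 _ Cphi _ [_ [f fdense]].
(* The orbit is bounded by [B1_norm f] at [p], and an element of the unit ball
   around [g] differs from [g] by less than 1 there. *)
have [p /(_ (B1_norm f + 1))[g gp]] := B1_unbounded_at R.
have [|h [gh [n _ fnh]]] := fdense (ball g 1) _ (ball_open _ _).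
  by exists g; exact: ballxx.
have hp : normc (h p) <= B1_norm f.
  rewrite -fnh (iter_composition_operator l1 Cphi).
  exact: normc_le_B1_norm (B1_inP f).
have ghp : normc ((g - h) p) < 1.
  apply: le_lt_trans (normc_le_B1_norm p (B1_inP (g - h))) _.
  by move: gh; rewrite -ball_normE /= B1_normE ltcR.
have := le_normcD ((g - h) p) (h p).
rewrite subrK gp ger0_norm ?addr_ge0 ?B1_norm_ge0//; last exact: B1_inP.
by move=> /le_lt_trans/(_ (ltr_leD ghp hp)); rewrite addrC ltxx.
Qed.
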